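(* Let $d\ge 3$. The number of universal types for unoriented lines in $\mathbb{R}^d$ is at least $2^{d-2}-1$; that is, there are at least $2^{d-2}-1$ distinct values $m$ of $F$ such that for every $n\ge d$ there exists a homogeneous sequence of $n$ lines in $\mathbb{R}^d$ all of whose $d$-tuples are mapped by $F$ to $m$.
   Context: A line in $\mathbb{R}^d$ is an equivalence class of pairs $(a,v)$, $v\ne 0$, with $(a,v)\sim(a+\alpha v,\beta v)$ for $\alpha\in\mathbb{R}$, $\beta\ne0$. For an ordered $d$-tuple $L_1,\ldots,L_d$ with $L_i$ represented by $(a_i,v_i)$ and $j\in[d]$, put $h_{j,i}=\det(a_i,v_1,\ldots,v_{j-1},v_{j+1},\ldots,v_d)$, $i\in[d]\setminus\{j\}$. The tuple is in general position if for each $j$ these numbers are pairwise distinct; then $\sigma_j$ is the ordering of $[d]\setminus\{j\}$ (identified with a permutation of $[d-1]$) by increasing $h_{j,i}$, and $\sigma_j^*$ its reverse. $F$ maps the tuple to $(\{\sigma_1,\sigma_1^*\},\ldots,\{\sigma_d,\sigma_d^*\})$. A sequence of lines is homogeneous if all its $d$-tuples $L_{i_1},\ldots,L_{i_d}$, $i_1<\dots<i_d$, are in general position and have the same $F$-value. *)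

(* Defs.v *)
From HB Require Import structures.
From mathcomp Require Import all_boot all_order all_algebra all_fingroup.
From mathcomp Require Import boolp reals generic_quotient.

Set Implicit Arguments.
Unset Strict Implicit.
Unset Printing Implicit Defensive.

Import Order.TTheory GRing.Theory Num.Theory.
Local Open Scope ring_scope.

Definition line_rep (R : realType) (d : nat) : Type :=
  {p : 'cV[R]_d * 'cV[R]_d | p.2 != 0}.

HB.instance Definition _ (R : realType) (d : nat) :=
  Choice.on (line_rep R d).

Definition base (R : realType) (d : nat) (p : line_rep R d) : 'cV[R]_d :=
  (val p).1.

Definition dir (R : realType) (d : nat) (p : line_rep R d) : 'cV[R]_d :=
  (val p).2.

Definition same_line (R : realType) (d : nat) : rel (line_rep R d) :=
  fun p q => `[< exists alpha beta : R,
    [/\ beta != 0, base q = base p + alpha *: dir p & dir q = beta *: dir p] >].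

Lemma same_line_refl (R : realType) (d : nat) : reflexive (@same_line R d).
Proof.
move=> p; apply/asboolP; exists 0, 1.
by rewrite oner_neq0 scale0r addr0 scale1r.
Qed.

Lemma same_line_sym (R : realType) (d : nat) : symmetric (@same_line R d).
Proof.
have half p q : @same_line R d p q -> same_line q p.
  move=> /asboolP[a [b [b0 ea ev]]]; apply/asboolP; exists (- (a / b)), b^-1.
  split; first by rewrite invr_eq0.
  - by rewrite ea ev scalerA mulNr divfK // scaleNr addrK.
  - by rewrite ev scalerA mulVf // scale1r.
by move=> p q; apply/idP/idP; apply: half.
Qed.

Lemma same_line_trans (R : realType) (d : nat) : transitive (@same_line R d).
Proof.
move=> q p r /asboolP[a [b [b0 ea ev]]] /asboolP[a' [b' [b0' ea' ev']]].
apply/asboolP; exists (a + a' * b), (b' * b); split.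
- by rewrite mulf_neq0.
- by rewrite ea' ea ev scalerA scalerDl addrA.
- by rewrite ev' ev scalerA.
Qed.

Canonical same_line_equiv (R : realType) (d : nat) :=
  EquivRel (@same_line R d) (@same_line_refl R d) (@same_line_sym R d)
           (@same_line_trans R d).

Definition line (R : realType) (d : nat) : Type :=
  {eq_quot (same_line_equiv R d)}%qT.

HB.instance Definition _ (R : realType) (d : nat) :=
  EqQuotient.on (line R d).
HB.instance Definition _ (R : realType) (d : nat) :=
  Choice.on (line R d).

(* The sets [d] \ {j} are enumerated increasingly by lift j : 'I_d.-1 -> 'I_d,
   with indices counted from 0. *)

Definition hmx (R : realType) (d : nat) (p : 'I_d -> line_rep R d)
    (j i : 'I_d) : 'M[R]_d :=
  \matrix_(r < d, c < d)
    (nth 0 (base (p i) :: [seq dir (p (lift j k)) | k <- enum 'I_d.-1]) c) r 0.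

Definition hdet (R : realType) (d : nat) (p : 'I_d -> line_rep R d)
    (j i : 'I_d) : R := \det (hmx p j i).

Definition rep_general_position (R : realType) (d : nat)
    (p : 'I_d -> line_rep R d) : Prop :=
  forall j i k : 'I_d, i != j -> k != j -> i != k -> hdet p j i != hdet p j k.

(* s is read in one-line notation: s k is the element in position k. *)
Definition increasing_order (R : realType) (d : nat)
    (p : 'I_d -> line_rep R d) (j : 'I_d) (s : 'S_d.-1) : bool :=
  [forall k : 'I_d.-1, forall l : 'I_d.-1, (k < l)%N ==>
     (hdet p j (lift j (s k)) < hdet p j (lift j (s l)))].

(* The default 1 is only returned outside general position: see
   rep_sigmaP and increasing_order_inj. *)
Definition rep_sigma (R : realType) (d : nat) (p : 'I_d -> line_rep R d)
    (j : 'I_d) : 'S_d.-1 :=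
  odflt 1%g [pick s : 'S_d.-1 | increasing_order p j s].

Definition reverse (n : nat) (s : 'S_n) : 'S_n :=
  perm (inj_comp (@perm_inj _ s) (@rev_ord_inj n)).

Definition line_type (d : nat) : Type := {ffun 'I_d -> {set 'S_d.-1}}.

HB.instance Definition _ (d : nat) := Finite.on (line_type d).

Definition rep_F (R : realType) (d : nat) (p : 'I_d -> line_rep R d) :
    line_type d :=
  [ffun j => [set rep_sigma p j; reverse (rep_sigma p j)]].

(* On lines, the notions are those of the canonical representatives; they do
   not depend on this choice: see general_positionE and FE. *)
Definition general_position (R : realType) (d : nat) (L : 'I_d -> line R d) :
    Prop :=
  rep_general_position (fun i => repr (L i)).

Definition F (R : realType) (d : nat) (L : 'I_d -> line R d) : line_type d :=
  rep_F (fun i => repr (L i)).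

Definition increasing (d n : nat) (t : 'I_d -> 'I_n) : Prop :=
  forall i k : 'I_d, (i < k)%N -> (t i < t k)%N.

Definition homogeneous (R : realType) (d n : nat) (L : 'I_n -> line R d) :
    Prop :=
  (forall t : 'I_d -> 'I_n, increasing t -> general_position (L \o t)) /\
  (forall t u : 'I_d -> 'I_n, increasing t -> increasing u ->
     F (L \o t) = F (L \o u)).

Definition universal_type (R : realType) (d : nat) (m : line_type d) : Prop :=
  forall n : nat, (d <= n)%N ->
    exists2 L : 'I_n -> line R d, homogeneous L &
      forall t : 'I_d -> 'I_n, increasing t -> F (L \o t) = m.

Lemma reverseK (n : nat) : involutive (@reverse n).
Proof. by move=> s; apply/permP => k; rewrite !permE /= permE /= rev_ordK. Qed.

Lemma hdet_same_line (R : realType) (d : nat) (p q : 'I_d -> line_rep R d) :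
  (forall i, same_line (p i) (q i)) ->
  forall j, exists2 c : R, c != 0 & forall i, i != j ->
    hdet q j i = c * hdet p j i.
Proof.
move=> pq j.
have [al /choice[be hbe]] := choice (fun i => asboolP _ (pq i)) => {pq}.
exists (\prod_(k < d.-1) be (lift j k)).
  by apply/prodf_neq0 => k _; case: (hbe (lift j k)).
move=> i ij.
case: d p q j al be hbe i ij => [|n] p q j al be hbe i ij; first by case: j {ij}.
have /unlift_some[k0 ik0 _] : j != i by rewrite eq_sym.
pose T : 'M[R]_n.+1 := \matrix_(r, c)
  (if unlift ord0 c is Some k then be (lift j k) *+ (r == c)
   else (r == 0)%:R + al i *+ (r == lift ord0 k0)).
have nthE (p' : 'I_n.+1 -> line_rep R n.+1) (k : 'I_n) :
    nth 0 [seq dir (p' (lift j l)) | l <- enum 'I_n.+1.-1] k = dir (p' (lift j k)).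
  by rewrite (nth_map k) ?size_enum_ord // nth_ord_enum.
have -> : hdet q j i = hdet p j i * \det T.
  rewrite /hdet -det_mulmx; congr (\det _); apply/matrixP => r c.
  rewrite !mxE big_ord_recl !mxE /=.
  under eq_bigr => k _ do rewrite !mxE /= nthE.
  case: (unliftP ord0 c) => [k ->|->] /=.
    rewrite mulr0n mulr0 add0r nthE (bigD1 k) //= eqxx mulr1n big1.
      by rewrite addr0; case: (hbe (lift j k)) => _ _ ->; rewrite mxE mulrC.
    by move=> l lk; rewrite (inj_eq lift_inj) (negbTE lk) mulr0.
  rewrite addr0 mulr1 (bigD1 k0) //= eqxx big1; last first.
    by move=> l lk; rewrite (inj_eq lift_inj) (negbTE lk) addr0 mulr0.
  case: (hbe i) => _ -> _; rewrite !mxE -ik0 add0r addr0 mulr1n.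
  by rewrite [al i * _]mulrC.
rewrite det_trig; last first.
  apply/is_trig_mxP => r c rc; rewrite mxE.
  case: (unliftP ord0 c) rc => [k ->|->] // rc.
  by case: eqP rc => // ->; rewrite ltnn.
rewrite big_ord_recl mxE unlift_none /= addr0 mul1r mulrC; congr (_ * _).
by apply: eq_bigr => k _; rewrite mxE liftK eqxx.
Qed.

Lemma increasing_perm1 (n : nat) (s : 'S_n) :
  (forall k l : 'I_n, (k < l)%N -> (s k < s l)%N) -> s = 1%g.
Proof.
have ge (t : {perm 'I_n}) : (forall k l : 'I_n, (k < l)%N -> (t k < t l)%N) ->
    forall (m : nat) (k : 'I_n), k = m :> nat -> (k <= t k)%N.
  move=> t_incr; elim=> [|m IH] k km; first by rewrite km.
  have mn : (m < n)%N by rewrite -ltnS -km ltnW // ltnS ltn_ord.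
  have := IH (Ordinal mn) erefl; rewrite km => /leq_ltn_trans; apply.
  by apply: t_incr; rewrite km.
move=> s_incr; apply/permP => k; rewrite perm1; apply/val_inj/eqP.
rewrite eqn_leq (ge s s_incr _ _ erefl) andbT -{2}(permK s k).
apply: (ge s^-1%g _ _ _ erefl) => a b ab; rewrite ltnNge; apply/negP.
rewrite leq_eqVlt => /orP[/eqP/val_inj/perm_inj eab|/s_incr].
  by rewrite eab ltnn in ab.
by rewrite !permKV ltnNge (ltnW ab).
Qed.

Lemma increasing_orderP (R : realType) (d : nat) (p : 'I_d -> line_rep R d)
    (j : 'I_d) (s : 'S_d.-1) :
  reflect (forall k l : 'I_d.-1, (k < l)%N ->
             hdet p j (lift j (s k)) < hdet p j (lift j (s l)))
          (increasing_order p j s).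
Proof.
apply: (iffP forallP) => [H k l kl|H k].
  by move/forallP/(_ l)/implyP: (H k); apply.
by apply/forallP => l; apply/implyP; apply: H.
Qed.

Lemma increasing_order_inj (R : realType) (d : nat) (p : 'I_d -> line_rep R d)
    (j : 'I_d) (s t : 'S_d.-1) :
  increasing_order p j s -> increasing_order p j t -> s = t.
Proof.
move=> /increasing_orderP hs /increasing_orderP ht.
suff /(canRL (mulgK _)) : (s * t^-1)%g = 1%g by rewrite mul1g invgK.
apply: increasing_perm1 => k l kl; rewrite !permM ltnNge leq_eqVlt.
apply/negP => /orP[/eqP/val_inj/perm_inj/perm_inj e|/ht].
  by rewrite e ltnn in kl.
by rewrite !permKV ltNge (ltW (hs _ _ kl)).
Qed.

Lemma rep_sigmaP (R : realType) (d : nat) (p : 'I_d -> line_rep R d)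
    (j : 'I_d) :
  rep_general_position p -> increasing_order p j (rep_sigma p j).
Proof.
move=> gp; rewrite /rep_sigma; case: pickP => [s //|noS] /=.
pose h (k : 'I_d.-1) := hdet p j (lift j k).
have h_inj : injective h.
  move=> k l /eqP hkl; apply/eqP; apply: contraTT hkl => kl.
  by apply: gp; rewrite ?(inj_eq lift_inj) // eq_sym neq_lift.
pose xs := sort (fun k l => h k <= h l) (enum 'I_d.-1).
have xs_size : size xs = d.-1 by rewrite size_sort size_enum_ord.
have xs_uniq : uniq xs by rewrite sort_uniq enum_uniq.
have xs_sorted : sorted (fun k l => h k <= h l) xs.
  by apply: sort_sorted => k l; apply: le_total.
have f_inj : injective (fun k : 'I_d.-1 => nth k xs k).
  move=> k l /=; rewrite (set_nth_default k l) ?xs_size // => /eqP.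
  by rewrite nth_uniq ?xs_size // => /eqP/val_inj.
suff : increasing_order p j (perm f_inj) by rewrite noS.
apply/increasing_orderP => k l kl; rewrite !permE.
rewrite -!/(h _) lt_neqAle (inj_eq h_inj).
rewrite [nth l xs l](set_nth_default k) ?xs_size //.
rewrite nth_uniq ?xs_size // neq_ltn kl /=.
apply: (@sorted_leq_nth _ (fun k l => h k <= h l)) => //; last exact: ltnW.
- by move=> a b c; apply: le_trans.
- by rewrite inE xs_size.
- by rewrite inE xs_size.
Qed.

Lemma increasing_order_same_line (R : realType) (d : nat)
    (p q : 'I_d -> line_rep R d) (j : 'I_d) :
  (forall i, same_line (p i) (q i)) ->
  (forall s, increasing_order q j s = increasing_order p j s) \/
  (forall s, increasing_order q j s = increasing_order p j (reverse s)).
Proof.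
move=> /hdet_same_line/(_ j)[c c0 hc].
have {}hc k : hdet q j (lift j k) = c * hdet p j (lift j k).
  by apply: hc; rewrite eq_sym neq_lift.
have [cp|cn|c00] := ltgtP 0 c; last by rewrite -c00 eqxx in c0.
  left=> s; apply: eq_forallb => k; apply: eq_forallb => l.
  by rewrite !hc ltr_pM2l.
have revL (k l : 'I_d.-1) : (k < l)%N -> (rev_ord l < rev_ord k)%N.
  by move=> kl; rewrite /= ltn_sub2l // (leq_ltn_trans kl).
right=> s; apply/increasing_orderP/increasing_orderP => H k l kl.
  rewrite !permE /=; have := H (rev_ord l) (rev_ord k).
  by rewrite !hc ltr_nM2l //; apply; apply: revL.
rewrite !hc ltr_nM2l //; have := H (rev_ord l) (rev_ord k).
by rewrite !permE /= !rev_ordK; apply; apply: revL.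
Qed.

Lemma rep_general_position_same_line (R : realType) (d : nat)
    (p q : 'I_d -> line_rep R d) :
  (forall i, same_line (p i) (q i)) ->
  rep_general_position p -> rep_general_position q.
Proof.
move=> /hdet_same_line pq gp j i k ij kj ik; have [c c0 hc] := pq j.
by rewrite !hc // (inj_eq (mulfI c0)); apply: gp.
Qed.

Lemma rep_F_same_line (R : realType) (d : nat) (p q : 'I_d -> line_rep R d) :
  (forall i, same_line (p i) (q i)) -> rep_general_position p ->
  rep_F q = rep_F p.
Proof.
move=> pq gp; have gq := rep_general_position_same_line pq gp.
apply/ffunP => j; rewrite !ffunE.
have sp := rep_sigmaP j gp; have sq := rep_sigmaP j gq.
have [e|e] := increasing_order_same_line j pq; rewrite e in sq.
  by rewrite (increasing_order_inj sq sp).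
by rewrite -(increasing_order_inj sq sp) reverseK setUC.
Qed.

Lemma same_line_repr (R : realType) (d : nat) (p : line_rep R d) :
  same_line p (repr (\pi_(line R d)%qT p)).
Proof. by rewrite -[same_line _ _]eqmodE reprK. Qed.

Lemma general_positionE (R : realType) (d : nat) (p : 'I_d -> line_rep R d) :
  general_position (fun i => \pi_(line R d)%qT (p i)) <->
  rep_general_position p.
Proof.
split; apply: rep_general_position_same_line => i; last exact: same_line_repr.
by rewrite same_line_sym; apply: same_line_repr.
Qed.

Lemma FE (R : realType) (d : nat) (p : 'I_d -> line_rep R d) :
  rep_general_position p -> F (fun i => \pi_(line R d)%qT (p i)) = rep_F p.
Proof. by apply: rep_F_same_line => i; apply: same_line_repr. Qed.

(* Main.v *)
Require Import Defs.
From mathcomp Require Import all_boot all_order all_algebra all_fingroup.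
From mathcomp Require Import boolp reals.
From mathcomp Require Import ring lra zify.

(* Put d = n + 1 and take the lines with direction (1, -t, ..., (-t)^n) and base
   point (0, e_1 t^2, e_2 t^4, ..., e_n t^(2n)), where the e_m are fixed signs
   and t runs through a sequence growing so fast that each term exceeds the
   cube of the previous one.  Expanding the determinant shows that h_{j,i} is,
   up to a nonzero factor depending on j only, sum_m e_m P_m t_i^(2m), where P
   is the monic polynomial whose roots are the -t_k, k <> j.  The coefficient
   P_m is close to the product of the n - m largest t_k, so if t_i is the i-th
   smallest of them, then the term m = i dominates: h_{j,i} has sign e_i, and
   its absolute value grows quickly with i.  Hence i precedes l > i in the
   ordering iff e_l = +1.  Reversing the sequence of lines gives the orderings
   where this is decided by the sign of the smaller index.  Up to reversal, each
   family has 2^(d-3) members, and the identity is the only common one. *)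

Set Implicit Arguments.
Unset Strict Implicit.
Unset Printing Implicit Defensive.

Import Order.TTheory GRing.Theory Num.Theory.
Local Open Scope ring_scope.

(** * Coefficients of polynomials with negative roots *)

Definition negroots_poly (R : realType) (s : nat -> R) (n : nat) : {poly R} :=
  \prod_(k < n) ('X + (s k)%:P).

Lemma size_prod_XaddC (R : realType) (I : finType) (u : I -> R) :
  size (\prod_k ('X + (u k)%:P)) = #|I|.+1.
Proof.
under eq_bigr => k _ do rewrite -[u k]opprK polyCN.
by rewrite size_prod_XsubC cardT enumT /index_enum; case: index_enum_key.
Qed.

Lemma monic_prod_XaddC (R : realType) (I : finType) (u : I -> R) :
  \prod_k ('X + (u k)%:P) \is monic.
Proof.
under eq_bigr => k _ do rewrite -[u k]opprK polyCN.
exact: monic_prod_XsubC.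
Qed.

(** The coefficient is the elementary symmetric polynomial of degree n - m: at most 2^n products,
    the largest being that of the last n - m values. In the induction, coefficient m + 1 becomes P_m
    + s_n P_(m+1), and [s m <= s n] bounds each summand by 2^n times the new product. *)
Lemma coef_negroots_poly_bounds (R : realType) (s : nat -> R) (n : nat) :
  (forall k, (k < n)%N -> 0 < s k) ->
  (forall k l, (k < l < n)%N -> s k <= s l) ->
  forall m, (m <= n)%N ->
    \prod_(m <= k < n) s k <= (negroots_poly s n)`_m
      <= 2 ^+ n * \prod_(m <= k < n) s k.
Proof.
rewrite /negroots_poly; elim: n => [|n IH] spos sle m mn.
  move: mn; rewrite leqn0 => /eqP ->.
  by rewrite big_geq // big_ord0 coef1 expr0 mulr1 lexx.
have {}IH m' : (m' <= n)%N -> \prod_(m' <= k < n) s k <= (negroots_poly s n)`_m'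
      <= 2 ^+ n * \prod_(m' <= k < n) s k.
  apply: IH => [k kn|k l kln]; first by apply: spos; lia.
  by apply: sle; lia.
have Epos m' : 0 < \prod_(m' <= k < n) s k.
  rewrite big_nat_cond; apply: prodr_gt0 => k; rewrite andbT => kn.
  by apply: spos; lia.
rewrite big_ord_recr /= -/(negroots_poly s n) mulrDr coefD coefMX coefMC.
have sn : 0 < s n by apply: spos.
have pow2 : 0 < 2 ^+ n :> R by rewrite exprn_gt0.
rewrite leq_eqVlt in mn; case/orP: mn => [/eqP ->|].
  rewrite big_geq // (nth_default _ (n := n.+1)) ?mul0r ?addr0.
    have := IH n (leqnn n); rewrite big_geq // => /andP[h1 h2].
    by rewrite /= exprS; apply/andP; split; lra.
  by rewrite size_prod_XaddC card_ord.
rewrite ltnS => mn; rewrite big_nat_recr //=.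
have /andP[l1 l2] := IH m mn.
have e1 := ler_wpM2r (ltW sn) l1; have e2 := ler_wpM2r (ltW sn) l2.
case: m mn l1 l2 e1 e2 => [|m] mn l1 l2 e1 e2 /=.
  rewrite add0r e1 exprS /=; have := Epos 0%N => E0.
  have := mulr_gt0 E0 sn => E0s.
  have := mulr_gt0 pow2 E0s; rewrite mulrA => E0s'.
  by rewrite -!mulrA; rewrite -!mulrA in E0s' e2; lra.
have /andP[k1 k2] := IH m (ltnW mn).
rewrite big_ltn // in k1 k2.
have sms : s m <= s n by apply: sle; rewrite mn ltnSn.
have Em := Epos m.+1.
have f1 : s m * \prod_(m.+1 <= k < n) s k <= s n * \prod_(m.+1 <= k < n) s k.
  by rewrite ler_pM2r.
have f2 := ler_wpM2l (ltW pow2) f1.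
have sm : 0 < s m by apply: spos; exact: ltn_trans mn _.
have f3 := mulr_gt0 sm Em.
apply/andP; split; first by lra.
by rewrite exprS; lra.
Qed.

Lemma coef_negroots_poly_gt0 (R : realType) (s : nat -> R) (n : nat) :
  (forall k, (k < n)%N -> 0 < s k) ->
  (forall k l, (k < l < n)%N -> s k <= s l) ->
  forall m, (m <= n)%N -> 0 < (negroots_poly s n)`_m.
Proof.
move=> spos sle m mn.
have /andP[+ _] := coef_negroots_poly_bounds spos sle mn.
apply: lt_le_trans; rewrite big_nat_cond; apply: prodr_gt0 => k.
by rewrite andbT => /andP[_]; apply: spos.
Qed.

(** P_m and s_m P_(m+1) are both estimated by the same product of the s_k with k >= m. *)
Lemma coef_negroots_poly_ratio (R : realType) (s : nat -> R) (n : nat) :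
  (forall k, (k < n)%N -> 0 < s k) ->
  (forall k l, (k < l < n)%N -> s k <= s l) ->
  forall m, (m < n)%N ->
    let P := negroots_poly s n in
    s m * P`_m.+1 <= 2 ^+ n * P`_m /\ P`_m <= 2 ^+ n * (s m * P`_m.+1).
Proof.
move=> spos sle m mn P.
have /andP[a1 a2] := coef_negroots_poly_bounds spos sle (ltnW mn).
have /andP[b1 b2] := coef_negroots_poly_bounds spos sle mn.
rewrite -/P in a1 a2 b1 b2; rewrite big_ltn // in a1 a2.
have sm := spos _ mn.
have pow2 : 0 < 2 ^+ n :> R by rewrite exprn_gt0.
have c1 := ler_wpM2l (ltW sm) b1; have c2 := ler_wpM2l (ltW sm) b2.
have d1 := ler_wpM2l (ltW pow2) a1.
have d2 := ler_wpM2l (ltW pow2) c1.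
by split; [lra | exact: le_trans d2].
Qed.

Lemma geometric_growth (R : realType) (K : R) (f : nat -> R) (a b : nat) :
  1 <= K -> (forall m, (a <= m < b)%N -> 0 < f m) ->
  (forall m, (a <= m < b)%N -> K * f m <= f m.+1) ->
  (a < b)%N -> K * f a <= f b.
Proof.
move=> K1 fpos fK; elim: b fpos fK => // b IH fpos fK.
rewrite ltnS leq_eqVlt => /orP[/eqP e|ab]; first by rewrite e; apply: fK; lia.
have h : K * f a <= f b.
  by apply: IH => // m mb; [apply: fpos|apply: fK]; lia.
have fb : 0 < f b by apply: fpos; lia.
apply: le_trans h _; have : K * f b <= f b.+1 by apply: fK; lia.
by apply: le_trans; rewrite ler_peMl // ltW.
Qed.

Lemma geometric_decay (R : realType) (K : R) (f : nat -> R) (a b : nat) :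
  1 <= K -> (forall m, (a < m <= b)%N -> 0 < f m) ->
  (forall m, (a <= m < b)%N -> K * f m.+1 <= f m) ->
  (a < b)%N -> K * f b <= f a.
Proof.
move=> K1 fpos fK; elim: b fpos fK => // b IH fpos fK.
rewrite ltnS leq_eqVlt => /orP[/eqP e|ab]; first by rewrite e; apply: fK; lia.
have h : K * f b <= f a.
  by apply: IH => // m mb; [apply: fpos|apply: fK]; lia.
have fb : 0 < f b by apply: fpos; lia.
apply: (@le_trans _ _ (f b)); first by apply: fK; lia.
by apply: le_trans h; rewrite ler_peMl // ltW.
Qed.

(** * The dominant term and its sign *)

Definition twisted_value (R : realType) (b : nat -> bool) (P : {poly R})
    (n : nat) (x : R) : R :=
  \sum_(m < n) (-1) ^+ (~~ b m) * (P`_m.+1 * x ^+ (2 * m.+1)).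

(** The factor 2^n pays for the comparison of coefficients, n + 1 for the number of competing terms,
    and 4 keeps their sum below a quarter of the dominant term. *)
Definition separation (R : realType) (n : nat) : R := 4 * n.+1%:R * 2 ^+ n.

Definition lacunary (R : realType) (n : nat) (s : nat -> R) : Prop :=
  (forall k, (k < n)%N -> separation R n <= s k) /\
  (forall k l, (k < l < n)%N -> s k ^+ 3 <= s l).

Lemma separation_ge4 (R : realType) (n : nat) : 4 <= separation R n.
Proof.
rewrite /separation -mulrA ler_peMr //.
have : 1 <= 2 ^+ n :> R by rewrite exprn_ege1 // ler1n.
have : 1 <= n.+1%:R :> R by rewrite ler1n.
by nra.
Qed.

Lemma lacunary_bounds (R : realType) (n : nat) (s : nat -> R) :
  lacunary n s ->
  [/\ forall k, (k < n)%N -> 1 < s k, forall k, (k < n)%N -> 0 < s k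
    & forall k l, (k < l < n)%N -> s k <= s l].
Proof.
move=> [big cube]; have S4 := separation_ge4 R n.
have s1 k : (k < n)%N -> 1 < s k by move=> /big; lra.
split=> // [k /s1|k l kln]; first lra.
apply: le_trans (cube _ _ kln).
by rewrite -{1}(expr1 (s k)) ler_eXn2l // s1 //; lia.
Qed.

(** With nodes counted from 0, the dominant term at node i has exponent index i + 1, and its sign is
    given by [b i]. *)
Definition magnitude (R : realType) (n : nat) (s : nat -> R) (i : nat) : R :=
  (negroots_poly s n)`_i.+1 * s i ^+ (2 * i.+1).

(** Put A_m = P_m s_i^(2m). Up to a factor 2^n, the ratio A_(k+1) / A_k is s_i^2 / s_k. It is thus
    at least s_i / 2^n for k <= i and, since s_k >= s_i^3, at most 2^n / s_i for k > i. So A rises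
    up to m = i + 1 and falls afterwards, by a factor of at least 4(n + 1) per step. *)
Lemma dominant_term (R : realType) (n : nat) (s : nat -> R) :
  lacunary n s -> forall i m, (i < n)%N -> (m <= n)%N -> m != i.+1 ->
  4 * n.+1%:R * ((negroots_poly s n)`_m * s i ^+ (2 * m)) <= magnitude n s i.
Proof.
move=> lac i m i_n mn mi; rewrite /magnitude.
pose A m := (negroots_poly s n)`_m * s i ^+ (2 * m).
rewrite -/(A m) -/(A i.+1); have [s1 s0 sle] := lacunary_bounds lac.
have [big cube] := lac.
have Ppos := coef_negroots_poly_gt0 s0 sle.
have Apos k : (k <= n)%N -> 0 < A k.
  by move=> kn; rewrite mulr_gt0 ?Ppos // exprn_gt0 // s0.
have K1 : 1 <= 4 * n.+1%:R :> R.
  have : 1 <= n.+1%:R :> R by rewrite ler1n.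
  lra.
have pow2 : 0 < 2 ^+ n :> R by rewrite exprn_gt0.
have Si := big _ i_n; rewrite /separation in Si.
have si0 := s0 _ i_n.
case: (ltnP m i.+1) => [mi'|im].
- apply: (geometric_growth K1) => // k /andP[_ ki].
    by apply: Apos; lia.
  have kn : (k < n)%N by lia.
  have [_ r] := coef_negroots_poly_ratio s0 sle kn.
  rewrite /A (_ : 2 * k.+1 = (2 * k).+2)%N; last by lia.
  rewrite !exprS; set X := s i ^+ _; set Q := (_)`_k; set Q' := (_)`_k.+1.
  have X0 : 0 < X by rewrite exprn_gt0.
  have Q'0 : 0 < Q' by apply: Ppos.
  have ski : s k <= s i.
    move: ki; rewrite ltnS leq_eqVlt => /orP[/eqP->//|ki].
    by apply: sle; lia.
  rewrite [leRHS](_ : _ = Q' * (s i * s i) * X); last by ring.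
  rewrite mulrA ler_pM2r //.
  apply: (@le_trans _ _ (4 * n.+1%:R * (2 ^+ n * (s k * Q')))).
    by rewrite ler_wpM2l //; lra.
  rewrite [leLHS](_ : _ = 4 * n.+1%:R * 2 ^+ n * s k * Q'); last by ring.
  rewrite [leRHS]mulrC ler_pM2r //.
  apply: ler_pM => //; [by rewrite mulr_ge0 // ltW//; lra| by rewrite ltW // s0].
- have {im mi} im : (i.+1 < m)%N by rewrite ltn_neqAle eq_sym mi.
  apply: (geometric_decay (f := A) K1) => // k /andP[ik km].
    by apply: Apos; lia.
  have kn : (k < n)%N by lia.
  have [r _] := coef_negroots_poly_ratio s0 sle kn.
  rewrite /A (_ : 2 * k.+1 = (2 * k).+2)%N; last by lia.
  rewrite !exprS; set X := s i ^+ _; move: r.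
  set Q := (_)`_k; set Q' := (_)`_k.+1 => r.
  have X0 : 0 < X by rewrite exprn_gt0.
  have Q'0 : 0 < Q' by apply: Ppos.
  have ski : s i ^+ 3 <= s k by apply: cube; lia.
  rewrite [leLHS](_ : _ = (4 * n.+1%:R) * (Q' * (s i * s i)) * X); last by ring.
  rewrite ler_pM2r // -(ler_pM2l pow2); apply: le_trans r.
  apply: (@le_trans _ _ (s i ^+ 3 * Q')); last by rewrite ler_pM2r.
  rewrite [leLHS](_ : _ = 4 * n.+1%:R * 2 ^+ n * (s i * s i * Q')); last by ring.
  rewrite [leRHS](_ : _ = s i * (s i * s i * Q')); last by ring.
  by rewrite ler_pM2r // !mulr_gt0.
Qed.

(** Passing from m to m + 1 brings two extra powers of s_(m+1): one makes up for the change of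
    coefficient, the other exceeds 4 * 2^n. *)
Lemma magnitude_growth (R : realType) (n : nat) (s : nat -> R) :
  lacunary n s -> forall i l, (i < l < n)%N ->
  4 * magnitude n s i <= magnitude n s l.
Proof.
move=> lac i l /andP[il ln]; have [s1 s0 sle] := lacunary_bounds lac.
have [big cube] := lac.
have Ppos := coef_negroots_poly_gt0 s0 sle.
apply: geometric_growth il; first by lra.
  by move=> m ml; rewrite mulr_gt0 ?Ppos ?exprn_gt0 ?s0 //; lia.
move=> m ml; have mn : (m.+1 < n)%N by lia.
have [_ r] := coef_negroots_poly_ratio s0 sle mn.
have pow2 : 0 < 2 ^+ n :> R by rewrite exprn_gt0.
have Sm := big _ mn; rewrite /separation in Sm.
rewrite /magnitude (_ : 2 * m.+2 = (2 * m.+1).+2)%N; last by lia.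
move: (2 * m.+1)%N => e; rewrite !exprS; move: r; set Q := (_)`_m.+1; set Q' := (_)`_m.+2 => r.
have Q'0 : 0 < Q' by apply: Ppos.
have sm := s0 _ (ltnW mn); have sm' := s0 _ mn.
have smm : s m <= s m.+1 by apply: sle; lia.
set X := s m ^+ _; set Y := s m.+1 ^+ _.
have X0 : 0 < X by rewrite exprn_gt0.
have XY : X <= Y by rewrite lerXn2r // nnegrE ltW.
apply: (@le_trans _ _ (4 * (2 ^+ n * (s m.+1 * Q') * X))).
  by rewrite ler_wpM2l // ler_pM2r.
rewrite [leLHS](_ : _ = (4 * 2 ^+ n) * (Q' * s m.+1) * X); last by ring.
rewrite [leRHS](_ : _ = s m.+1 * (Q' * s m.+1) * Y); last by ring.
apply: ler_pM => //; try by rewrite !mulr_ge0 // ltW.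
  by rewrite ltW.
rewrite ler_pM2r ?mulr_gt0 //; apply: le_trans Sm.
have : 1 <= n.+1%:R :> R by rewrite ler1n.
by nra.
Qed.

Lemma twisted_value_approx (R : realType) (n : nat) (s : nat -> R) b :
  lacunary n s -> forall i, (i < n)%N ->
  `|twisted_value b (negroots_poly s n) n (s i) -
      (-1) ^+ (~~ b i) * magnitude n s i| <= magnitude n s i / 4.
Proof.
move=> lac i i_n; rewrite /twisted_value (bigD1 (Ordinal i_n)) //=.
rewrite -/(magnitude n s i) [X in `|X|]addrC addKr.
have [s1 s0 sle] := lacunary_bounds lac.
have Ppos := coef_negroots_poly_gt0 s0 sle.
apply: le_trans (ler_norm_sum _ _ _) _.
(* The omitted index i is counted here too, giving n equal terms. *)
apply: (@le_trans _ _ (\sum_(k < n) magnitude n s i / (4 * n.+1%:R))).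
  rewrite big_mkcond /=; apply: ler_sum => k _.
  have M0 : 0 < magnitude n s i by rewrite mulr_gt0 ?Ppos ?exprn_gt0 ?s0.
  case: ifP => [ki|_]; last by rewrite ltW // divr_gt0 // mulr_gt0.
  rewrite normrM normr_sign mul1r ger0_norm; last first.
    by rewrite mulr_ge0 ?exprn_ge0 // ltW ?s0 ?Ppos.
  rewrite ler_pdivlMr ?mulr_gt0 // mulrC; apply: (dominant_term lac) => //.
rewrite sumr_const card_ord -[_ *+ n]mulr_natr.
have M0 : 0 < magnitude n s i by rewrite mulr_gt0 ?Ppos ?exprn_gt0 ?s0.
rewrite -mulrA ler_pM2l // invfM -mulrA.
apply: ler_piMr; first by rewrite invr_ge0.
by rewrite mulrC ler_pdivrMr // mul1r ler_nat.
Qed.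

(** The value at s_l is at least 3/4 of its magnitude, hence 3 times the magnitude at i, while the
    value at s_i is at most 5/4 of the latter. So the sign at l decides. *)
Lemma twisted_value_lt (R : realType) (n : nat) (s : nat -> R) b :
  lacunary n s -> forall i l, (i < l < n)%N ->
  let H := twisted_value b (negroots_poly s n) n in
  (H (s i) < H (s l)) = b l /\ (H (s l) < H (s i)) = ~~ b l.
Proof.
move=> lac i l iln H; have g := magnitude_growth lac iln.
have [i_n ln] : (i < n /\ l < n)%N by lia.
have := twisted_value_approx b lac i_n; have := twisted_value_approx b lac ln.
rewrite -!/H !ler_norml => hl hi.
have [s1 s0 sle] := lacunary_bounds lac.
have Ppos := coef_negroots_poly_gt0 s0 sle.
have M0 : 0 < magnitude n s i by rewrite mulr_gt0 ?Ppos ?exprn_gt0 ?s0.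
suff : if b l then H (s i) < H (s l) else H (s l) < H (s i).
  by case: (b l) => lt_H; rewrite lt_H lt_gtF.
by move: hl hi; case: (b l); case: (b i) => /= *; lra.
Qed.

(** * Determinants of the parametrized lines *)

Definition param_base (R : realType) (n : nat) (b : nat -> bool) (t : R) :
    'cV[R]_n.+1 :=
  \col_r (if val r is m.+1 then (-1) ^+ (~~ b m) * t ^+ (2 * m.+1) else 0).

Definition param_dir (R : realType) (n : nat) (t : R) : 'cV[R]_n.+1 :=
  \col_r (- t) ^+ r.

Lemma param_dir_neq0 (R : realType) (n : nat) (t : R) : param_dir n t != 0.
Proof. by apply/eqP => /colP/(_ ord0)/eqP; rewrite !mxE expr0 oner_eq0. Qed.

Definition param_line (R : realType) (n : nat) (b : nat -> bool) (t : R) :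
    line_rep R n.+1 :=
  exist _ (param_base n b t, param_dir n t) (param_dir_neq0 n t).

(** The directions form a Vandermonde matrix. Combining its rows with the coefficients of P
    evaluates P at the points -u_k, k <> j, which are roots, so expansion along the combined row
    leaves only the entry of the base point. *)
Lemma hdet_param_line (R : realType) (n : nat) (b : nat -> bool)
    (u : 'I_n.+1 -> R) :
  injective u -> forall j, exists2 c : R, c != 0 & forall i,
    hdet (fun i => param_line n b (u i)) j i =
    c * twisted_value b (\prod_(k < n) ('X + (u (lift j k))%:P)) n (u i).
Proof.
move=> u_inj j; set P := \prod_(k < n) _; set p := fun i => param_line n b (u i).
have sizeP : size P = n.+1 by rewrite size_prod_XaddC card_ord.
have Pn : P`_n = 1.
  have /monicP := monic_prod_XaddC (fun k : 'I_n => u (lift j k)).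
  by rewrite lead_coefE sizeP.
(* Multiplying by U replaces the last row by (sum_m P_m a_m, 0, ..., 0). *)
pose U : 'M[R]_n.+1 :=
  \matrix_(r, c) (if r == ord_max then P`_c else (r == c)%:R).
pose V := Vandermonde n (\row_(k < n) (- u (lift j k))).
have detU : \det U = 1.
  rewrite det_trig.
    rewrite big1 // => r _; rewrite mxE; case: eqP => [->|_]; first exact: Pn.
    by rewrite eqxx.
  apply/is_trig_mxP => r c rc; rewrite mxE; case: eqP => [er|_].
    by move: rc; rewrite er /= ltnNge -ltnS ltn_ord.
  by case: eqP rc => // ->; rewrite ltnn.
(* This is the cofactor of the last entry in the first column; distinct parameters make it
   nonzero. *)
exists ((-1) ^+ n * \det V).
  apply: mulf_neq0; first by rewrite signr_eq0.
  rewrite det_Vandermonde.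
  apply/prodf_neq0 => a _; apply/prodf_neq0 => c ac.
  rewrite !mxE subr_eq0 eqr_opp.
  apply/eqP => /u_inj/lift_inj e; by rewrite e ltnn in ac.
move=> i; have -> : hdet p j i = \det (U *m hmx p j i).
  by rewrite det_mulmx detU mul1r.
have nthE (k : 'I_n) :
    nth 0 [seq dir (p (lift j l)) | l <- enum 'I_n.+1.-1] k = dir (p (lift j k)).
  by rewrite (nth_map k) ?size_enum_ord // nth_ord_enum.
have rowmax c : (U *m hmx p j i) ord_max c = \sum_(r < n.+1) P`_r * hmx p j i r c.
  by rewrite mxE; apply: eq_bigr => r _; rewrite mxE eqxx.
rewrite (expand_det_row _ ord_max) big_ord_recl /= big1 => [|k _]; last first.
  rewrite rowmax; under eq_bigr => r _ do rewrite mxE /= nthE mxE.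
  suff -> : \sum_(r < n.+1) P`_r * (- u (lift j k)) ^+ r = 0 by rewrite mul0r.
  have := horner_coef P (- u (lift j k)); rewrite sizeP => <-.
  rewrite /P horner_prod (bigD1 k) //=.
  by rewrite hornerD hornerX hornerC addNr mul0r.
rewrite addr0 rowmax mulrC; congr (_ * _).
  rewrite /cofactor /= addn0; congr (_ * \det _); apply/matrixP => r c.
  rewrite !mxE (bigD1 (lift ord_max r)) //= big1 => [|l lr].
    rewrite !mxE /= eq_sym (negbTE (neq_lift _ _)) eqxx mul1r addr0 nthE mxE.
    by rewrite /= /bump leqNgt ltn_ord.
  by rewrite !mxE eq_sym (negbTE (neq_lift _ _)) eq_sym (negbTE lr) mul0r.
rewrite big_ord_recl !mxE /= mulr0 add0r /twisted_value.
by apply: eq_bigr => m _; rewrite !mxE /= mulrCA.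
Qed.

(** * Line types described by relations *)

Definition tournament (T : eqType) (r : rel T) : Prop :=
  forall k l, k != l -> r k l = ~~ r l k.

Definition sorted_by (n : nat) (r : rel 'I_n) (s : 'S_n) : bool :=
  [forall k : 'I_n, forall l : 'I_n, (k < l)%N ==> r (s k) (s l)].

Lemma sorted_byP (n : nat) (r : rel 'I_n) (s : 'S_n) :
  reflect (forall k l : 'I_n, (k < l)%N -> r (s k) (s l)) (sorted_by r s).
Proof.
apply: (iffP forallP) => [H k l kl|H k].
  by move/forallP/(_ l)/implyP: (H k); apply.
by apply/forallP => l; apply/implyP; apply: H.
Qed.

(** The same pair is taken for every j. Describing it by membership avoids choosing a sorting
    permutation and makes it visibly closed under reversal. *)
Definition type_of_rel (n : nat) (r : rel 'I_n) : line_type n.+1 :=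
  [ffun _ => [set s : 'S_n | sorted_by r s || sorted_by r (reverse s)]].

(** The factor c may depend on j and be negative: this at most reverses the ordering, which the type
    does not see. *)
Definition realizes (R : realType) (n : nat) (p : 'I_n.+1 -> line_rep R n.+1)
    (r : rel 'I_n) : Prop :=
  forall j, exists2 c : R, c != 0 & forall k l : 'I_n, k != l ->
    (c * hdet p j (lift j k) < c * hdet p j (lift j l)) = r k l.

Lemma realizes_general_position (R : realType) (n : nat)
    (p : 'I_n.+1 -> line_rep R n.+1) (r : rel 'I_n) :
  tournament r -> realizes p r -> rep_general_position p.
Proof.
move=> tr pr j i k; rewrite eq_sym => /unlift_some[i' -> _].
rewrite eq_sym => /unlift_some[k' -> _]; rewrite (inj_eq lift_inj) => ik.
apply/eqP => e; have [c _ hc] := pr j; have ki : k' != i' by rewrite eq_sym.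
by have := tr _ _ ik; rewrite -hc // -hc // e ltxx.
Qed.

Lemma rev_ord_lt (n : nat) (k l : 'I_n) :
  (rev_ord k < rev_ord l)%N = (l < k)%N.
Proof. by have := ltn_ord k; have := ltn_ord l; rewrite /=; lia. Qed.

Lemma rep_F_realizes (R : realType) (n : nat)
    (p : 'I_n.+1 -> line_rep R n.+1) (r : rel 'I_n) :
  tournament r -> realizes p r -> rep_F p = type_of_rel r.
Proof.
move=> tr pr; have gp := realizes_general_position tr pr.
apply/ffunP => j; rewrite !ffunE; apply/setP => s; rewrite !inE.
have sigE t : (t == rep_sigma p j) = increasing_order p j t.
  apply/eqP/idP => [->|]; first exact: rep_sigmaP.
  by move=> ht; apply: increasing_order_inj ht (rep_sigmaP _ gp).
rewrite -(can_eq (@reverseK _) s (reverse _)) reverseK !sigE {sigE}.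
have [c c0 hc] := pr j.
have [cp|cn|c00] := ltgtP 0 c; last by rewrite -c00 eqxx in c0.
  have incE t : increasing_order p j t = sorted_by r t.
    apply: eq_forallb => k; apply: eq_forallb => l.
    have [kl|//] := boolP (k < l)%N.
    rewrite /= -hc ?ltr_pM2l //.
    by apply: contraTneq kl => /perm_inj ->; rewrite ltnn.
  by rewrite !incE.
have incE t : increasing_order p j t = sorted_by r (reverse t).
  have ne (k l : 'I_n) : (k < l)%N -> t l != t k.
    by apply: contraTneq => /perm_inj ->; rewrite ltnn.
  apply/increasing_orderP/sorted_byP => H k l kl.
    rewrite !permE /= -hc ?ltr_nM2l //; last by apply: ne; rewrite rev_ord_lt.
    by apply: H; rewrite rev_ord_lt.
  rewrite -(ltr_nM2l cn) hc ?ne //.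
  have := H (rev_ord l) (rev_ord k); rewrite !permE /= !rev_ordK; apply.
  by rewrite rev_ord_lt.
by rewrite !incE reverseK orbC.
Qed.

Lemma sorted_by_lt (n : nat) (r : rel 'I_n) (s : 'S_n) (x y : 'I_n) :
  tournament r -> sorted_by r s -> x != y -> r (s x) (s y) = (x < y)%N.
Proof.
move=> tr /sorted_byP srt xy; case: (ltngtP x y) => [/srt->//|yx|/val_inj e].
  by rewrite tr ?(inj_eq perm_inj) // srt.
by rewrite e eqxx in xy.
Qed.

(** A permutation sorting [r] sorts [r'] either directly or in reverse; the common comparison of a
    and b excludes the latter. *)
Lemma type_of_rel_inj (n : nat) (r r' : rel 'I_n) (a b : 'I_n) :
  tournament r -> tournament r' -> (exists s, sorted_by r s) ->
  a != b -> r a b -> r' a b -> type_of_rel r = type_of_rel r' ->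
  forall k l, k != l -> r k l = r' k l.
Proof.
move=> tr tr' [s srt] ab rab r'ab /ffunP/(_ ord0)/setP/(_ s).
rewrite !ffunE !inE srt /= => /esym/orP[srt'|srt'] k l kl.
  have ne : (s^-1)%g k != (s^-1)%g l by rewrite (inj_eq perm_inj).
  by rewrite -(permKV s k) -(permKV s l) (sorted_by_lt tr srt ne)
    (sorted_by_lt tr' srt' ne).
have r'E x y : x != y -> r' (s x) (s y) = (y < x)%N.
  move=> xy; have sE z : s z = reverse s (rev_ord z).
    by rewrite permE /= rev_ordK.
  by rewrite !sE (sorted_by_lt tr' srt') ?(inj_eq rev_ord_inj) // rev_ord_lt.
have ne : (s^-1)%g a != (s^-1)%g b by rewrite (inj_eq perm_inj).
move: rab r'ab; rewrite -(permKV s a) -(permKV s b) r'E //.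
rewrite (sorted_by_lt tr srt ne).
by move=> /ltnW; rewrite leqNgt => /negbTE ->.
Qed.

Lemma universal_type_of_rel (R : realType) (n : nat) (r : rel 'I_n) :
  tournament r ->
  (forall N, exists u : 'I_N -> line_rep R n.+1,
     forall t : 'I_n.+1 -> 'I_N, increasing t -> realizes (u \o t) r) ->
  universal_type R (type_of_rel r).
Proof.
move=> tr ur N _; have [u hu] := ur N.
pose L i : line R n.+1 := \pi_(line R n.+1)%qT (u i).
have gp t : increasing t -> general_position (L \o t).
  move=> /hu/(realizes_general_position tr) g.
  exact: (general_positionE (u \o t)).2.
have FL t : increasing t -> F (L \o t) = type_of_rel r.
  move=> /hu ht; rewrite -(rep_F_realizes tr ht).
  exact: (FE (realizes_general_position tr ht)).
by exists L => //; split=> // t t' /FL -> /FL ->.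
Qed.

(** * The two families of orderings *)

Definition inc_rel (n : nat) (b : nat -> bool) : rel 'I_n :=
  fun k l => if (k < l)%N then b l else ~~ b k.

(** Mirroring the indices makes the smaller one decide. The arguments are also exchanged, so that
    constant sign + gives the identity ordering in both families. *)
Definition dec_rel (n : nat) (b : nat -> bool) : rel 'I_n :=
  fun k l => inc_rel b (rev_ord l) (rev_ord k).

Lemma inc_rel_tournament (n : nat) (b : nat -> bool) :
  tournament (@inc_rel n b).
Proof.
move=> k l kl; rewrite /inc_rel; case: (ltngtP k l) => [_|_|/val_inj e].
- by rewrite negbK.
- by [].
- by rewrite e eqxx in kl.
Qed.

Lemma dec_rel_tournament (n : nat) (b : nat -> bool) :
  tournament (@dec_rel n b).
Proof.
by move=> k l kl; apply: inc_rel_tournament; rewrite (inj_eq rev_ord_inj) eq_sym.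
Qed.

Lemma twisted_value_inc_rel (R : realType) (n : nat) (s : nat -> R) b :
  lacunary n s -> forall k l : 'I_n, k != l ->
  let H := twisted_value b (negroots_poly s n) n in
  (H (s k) < H (s l)) = inc_rel b k l.
Proof.
move=> lac k l kl H; rewrite /inc_rel; case: (ltngtP k l) => [h|h|/val_inj e].
- by have [|->] := @twisted_value_lt _ _ _ b lac k l; rewrite ?h ?ltn_ord.
- by have [|_ ->] := @twisted_value_lt _ _ _ b lac l k; rewrite ?h ?ltn_ord.
- by rewrite e eqxx in kl.
Qed.

Lemma ltn_lift (n : nat) (j : 'I_n) (k l : 'I_n.-1) :
  (lift j k < lift j l)%N = (k < l)%N.
Proof. by rewrite !ltnNge leq_bump2. Qed.

Lemma realizes_inc_rel (R : realType) (n : nat) b (u : 'I_n.+2 -> R) :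
  (forall i, separation R n.+1 <= u i) ->
  (forall i k : 'I_n.+2, (i < k)%N -> u i ^+ 3 <= u k) ->
  injective u -> realizes (fun i => param_line n.+1 b (u i)) (@inc_rel n.+1 b).
Proof.
move=> big cube u_inj j; have [c c0 hc] := hdet_param_line b u_inj j.
exists c^-1; first by rewrite invr_eq0.
move=> k l kl; rewrite !hc !mulKf //.
(* As [lift j] is increasing, the parameters other than that of j still form a lacunary sequence;
   [inord] only extends it to all of [nat]. *)
pose s (k : nat) := u (lift j (inord k)).
have sE (x : 'I_n.+1) : u (lift j x) = s x by rewrite /s inord_val.
have -> : \prod_(k < n.+1) ('X + (u (lift j k))%:P) = negroots_poly s n.+1.
  by apply: eq_bigr => x _; rewrite sE.
rewrite !sE; apply: twisted_value_inc_rel => //; split=> [x _|x y xyn].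
  exact: big.
by apply: cube; rewrite ltn_lift !inordK; lia.
Qed.

Lemma realizes_dec_rel (R : realType) (n : nat) b (u : 'I_n.+2 -> R) :
  (forall i, separation R n.+1 <= u i) ->
  (forall i k : 'I_n.+2, (i < k)%N -> u k ^+ 3 <= u i) ->
  injective u -> realizes (fun i => param_line n.+1 b (u i)) (@dec_rel n.+1 b).
Proof.
move=> big cube u_inj j; have [c c0 hc] := hdet_param_line b u_inj j.
(* The minus sign matches the exchange of arguments in [dec_rel]. *)
exists (- c^-1); first by rewrite oppr_eq0 invr_eq0.
move=> k l kl; rewrite !hc !mulNr !mulKf // ltrN2.
pose s (k : nat) := u (lift j (rev_ord (inord k))).
have sE (x : 'I_n.+1) : u (lift j x) = s (rev_ord x).
  by rewrite /s inord_val rev_ordK.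
have -> : \prod_(k < n.+1) ('X + (u (lift j k))%:P) = negroots_poly s n.+1.
  rewrite /negroots_poly [RHS](reindex_inj rev_ord_inj) /=.
  by apply: eq_bigr => x _; rewrite sE.
rewrite !sE; apply: twisted_value_inc_rel; last first.
  by rewrite (inj_eq rev_ord_inj) eq_sym.
split=> [x _|x y xyn]; first exact: big.
by apply: cube; rewrite ltn_lift rev_ord_lt !inordK; lia.
Qed.

(** * Fast growing parameters and universality *)

Definition tower (R : realType) (n k : nat) : R := separation R n ^+ (3 ^ k).

Lemma tower_ge (R : realType) (n k : nat) : separation R n <= tower R n k.
Proof.
have := separation_ge4 R n => S4.
by rewrite /tower -{1}[separation R n]expr1 ler_eXn2l ?expn_gt0 //; lra.
Qed.

Lemma tower_cube (R : realType) (n k l : nat) :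
  (k < l)%N -> tower R n k ^+ 3 <= tower R n l.
Proof.
move=> kl; have := separation_ge4 R n => S4.
rewrite /tower -exprM -expnSr ler_eXn2l; last by lra.
by rewrite leq_exp2l.
Qed.

Lemma tower_inj (R : realType) (n : nat) : injective (tower R n).
Proof.
move=> k l e; have S4 := separation_ge4 R n.
apply: (@expnI 3) => //; apply: ieexprIn e; first by lra.
by rewrite gt_eqF //; lra.
Qed.

Lemma increasing_inj (d n : nat) (t : 'I_d -> 'I_n) :
  increasing t -> injective t.
Proof.
move=> tinc i k e; case: (ltngtP i k) => [/tinc|/tinc|/val_inj//];
  by rewrite e ltnn.
Qed.

Lemma universal_inc_rel (R : realType) (n : nat) b :
  universal_type R (type_of_rel (@inc_rel n.+1 b)).
Proof.
apply: universal_type_of_rel => [|N]; first exact: inc_rel_tournament.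
exists (fun i => param_line n.+1 b (tower R n.+1 i)) => t tinc.
apply: realizes_inc_rel => [i|i k /tinc ik|i k]; first exact: tower_ge.
- exact: tower_cube.
- by move=> /tower_inj/val_inj/(increasing_inj tinc).
Qed.

Lemma universal_dec_rel (R : realType) (n : nat) b :
  universal_type R (type_of_rel (@dec_rel n.+1 b)).
Proof.
apply: universal_type_of_rel => [|N]; first exact: dec_rel_tournament.
exists (fun i => param_line n.+1 b (tower R n.+1 (rev_ord i))) => t tinc.
apply: realizes_dec_rel => [i|i k /tinc ik|i k]; first exact: tower_ge.
- by apply: tower_cube; rewrite rev_ord_lt.
- by move=> /tower_inj/val_inj/rev_ord_inj/(increasing_inj tinc).
Qed.

(** * Counting the types *)

(* The sign of the smallest element is irrelevant, and that of the largest one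
   is normalized to + (the default value of nth), so that 0 < n - 1 in the
   ordering: this selects one of each pair of mutually reverse orderings. *)
Definition word_sign (q : nat) (w : q.-tuple bool) (k : nat) : bool :=
  nth true w k.-1.

Definition word_rel (q : nat) (x : bool * q.-tuple bool) : rel 'I_q.+2 :=
  if x.1 then dec_rel (word_sign x.2) else inc_rel (word_sign x.2).

Lemma word_rel_tournament (q : nat) (x : bool * q.-tuple bool) :
  tournament (word_rel x).
Proof.
rewrite /word_rel; case: x.1; [exact: dec_rel_tournament|exact: inc_rel_tournament].
Qed.

Lemma universal_word_rel (R : realType) (q : nat) (x : bool * q.-tuple bool) :
  universal_type R (type_of_rel (word_rel x)).
Proof.
rewrite /word_rel; case: x.1; [exact: universal_dec_rel|exact: universal_inc_rel].
Qed.

(** Comparisons with 0 reveal the word in the first family; in the second, the normalized sign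
    decides them all. Comparisons with the last element behave the opposite way. *)
Lemma word_rel_first (q : nat) (x : bool * q.-tuple bool) (l : 'I_q.+2) :
  l != ord0 -> word_rel x ord0 l = x.1 || word_sign x.2 l.
Proof.
case: x => [[] w] /= l0; rewrite /word_rel /= /dec_rel /inc_rel /=; last first.
  by rewrite lt0n l0.
have -> : (q.+2 - l.+1 < q.+2 - 1)%N.
  have : (l : nat) != 0%N by [].
  have := ltn_ord l; lia.
by rewrite /word_sign nth_default // size_tuple; lia.
Qed.

Lemma word_rel_last (q : nat) (x : bool * q.-tuple bool) (l : 'I_q.+2) :
  l != ord_max -> word_rel x l ord_max = ~~ x.1 || word_sign x.2 (rev_ord l).
Proof.
case: x => [[] w] /= l0; rewrite /word_rel /= /dec_rel /inc_rel /=; last first.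
  have -> : (l < q.+1)%N.
    have : (l : nat) != q.+1 by [].
    have := ltn_ord l; lia.
  by rewrite /word_sign nth_default // size_tuple.
rewrite subnn; case: ifP => //; have : (l : nat) != q.+1 by [].
by have := ltn_ord l; lia.
Qed.

(** Transitivity comes from geometry: lines realizing the type have an ordering sigma_0, which
    belongs to the pair. *)
Lemma word_rel_sorted_by (R : realType) (q : nat) (x : bool * q.-tuple bool) :
  exists s, sorted_by (word_rel x) s.
Proof.
have [L _ /(_ id (fun i k ik => ik)) FL] :=
  @universal_word_rel R q x q.+3 (leqnn _).
have [s] : exists s, s \in F (L \o id) ord0.
  by eexists; rewrite ffunE; exact: set21.
by rewrite FL ffunE inE => /orP[h|h]; eexists; exact: h.
Qed.

(** Comparisons with the first and last elements recover the word within a family. Across families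
    they force both words to be constantly +, which is the identity ordering, kept only in the first
    family. *)
Lemma type_of_word_rel_inj (R : realType) (q : nat) :
  {in [set~ (true, nseq_tuple q true)] &,
    injective (fun x => type_of_rel (@word_rel q x))}.
Proof.
move=> x y; rewrite !inE => xne yne e.
have last0 : ord0 != ord_max :> 'I_q.+2 by [].
have first_last (z : bool * q.-tuple bool) : word_rel z ord0 ord_max.
  rewrite word_rel_first // /word_sign nth_default ?orbT // size_tuple.
  exact: leqnn.
have {}e := type_of_rel_inj (word_rel_tournament x) (word_rel_tournament y)
  (word_rel_sorted_by R x) last0 (first_last x) (first_last y) e.
have e1 (k : nat) : (k < q)%N -> x.1 || nth true x.2 k = y.1 || nth true y.2 k.
  move=> kq; have kq2 : (k.+1 < q.+2)%N by lia.
  by have := e ord0 (Ordinal kq2) isT; rewrite !word_rel_first.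
have e2 (k : nat) : (k < q)%N ->
    ~~ x.1 || nth true x.2 k = ~~ y.1 || nth true y.2 k.
  (* The mirror image of q - k is k + 1, whose sign is letter k of the word. *)
  move=> kq; have kq2 : (q - k < q.+2)%N by lia.
  have ne : Ordinal kq2 != ord_max.
    by apply/eqP => /(congr1 val) /=; lia.
  have := e (Ordinal kq2) ord_max ne; rewrite !word_rel_last // /word_sign /=.
  by rewrite (_ : (q.+2 - (q - k).+1).-1 = k) //; lia.
have all_true (w : q.-tuple bool) :
    (forall k, (k < q)%N -> nth true w k) -> w = nseq_tuple q true.
  move=> h; apply: val_inj; apply: (@eq_from_nth _ true).
    by rewrite size_tuple size_nseq.
  by move=> k; rewrite size_tuple => kq; rewrite h //= nth_nseq kq.
case: x y xne yne e1 e2 {e} => [[] w] [[] w'] /= xne yne e1 e2.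
- congr pair; apply: val_inj; apply: (@eq_from_nth _ true).
    by rewrite !size_tuple.
  by move=> k; rewrite size_tuple => /e2.
- by rewrite (all_true w) ?eqxx // in xne => k /e2 ->.
- by rewrite (all_true w') ?eqxx // in yne => k /e2 <-.
- congr pair; apply: val_inj; apply: (@eq_from_nth _ true).
    by rewrite !size_tuple.
  by move=> k; rewrite size_tuple => /e1.
Qed.

Local Close Scope ring_scope.

Theorem theorem4p3 (R : realType) (d : nat) (hd : 3 <= d) :
  2 ^ (d - 2) - 1 <=
    #|[set m : line_type d | `[< universal_type R m >] ]|.
Proof.
case: d hd => [|[|[|q]]] // _.
pose A := [set~ (true, nseq_tuple q true)].
(* There are two families of 2^q words each, minus the excluded pair, and q + 1 = d - 2. *)
have -> : 2 ^ (q.+3 - 2) - 1 = #|(fun x => type_of_rel (word_rel x)) @: A|.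
  rewrite (card_in_imset (@type_of_word_rel_inj R q)) cardsC1 card_prod.
  by rewrite card_bool card_tuple card_bool -expnS subn1 !subSS subn0.
apply/subset_leq_card/subsetP => m /imsetP[x _ ->].
by rewrite inE; apply/asboolP; exact: universal_word_rel.
Qed.
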